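(* Consider a stationary imprecise Markov chain with finite state set $\mathcal{X}$ and upper transition operator $\overline{T}$ that is regularly absorbing. Then there is an upper expectation $\overline{E}_\infty$ on $\mathcal{L}(\mathcal{X})$ such that for every initial upper expectation $\overline{E}_1$ on $\mathcal{L}(\mathcal{X})$, the upper expectation $\overline{E}_n=\overline{E}_1\circ\overline{T}^{\,n-1}$ for the state at time $n$ converges point-wise to $\overline{E}_\infty$: $$\lim_{n\to\infty}\overline{E}_n(h)=\lim_{n\to\infty}\overline{E}_1(\overline{T}^{\,n-1}h)=\overline{E}_\infty(h)\quad\text{for all }h\in\mathcal{L}(\mathcal{X}).$$ Moreover, $\overline{E}_\infty$ is the only $\overline{T}$-invariant upper expectation on $\mathcal{L}(\mathcal{X})$.
   Context: $\mathcal{X}$ is a finite non-empty set and $\mathcal{L}(\mathcal{X})$ is the set of real-valued maps on $\mathcal{X}$; $I_A$ is the indicator of $A\subseteq\mathcal{X}$; $\mathbb{N}=\{1,2,\dots\}$. An upper expectation on $\mathcal{L}(\mathcal{X})$ is a functional $\overline{E}:\mathcal{L}(\mathcal{X})\to\mathbb{R}$ such that (i) $\min g\le\overline{E}(g)\le\max g$; (ii) $\overline{E}(g_1+g_2)\le\overline{E}(g_1)+\overline{E}(g_2)$; (iii) $\overline{E}(\lambda g)=\lambda\overline{E}(g)$ for real $\lambda\ge0$. Equivalently, $\overline{E}(g)=\max_{p\in\mathcal{P}}\sum_x g(x)p(x)$ for some credal set $\mathcal{P}$, i.e. a non-empty closed convex set of probability mass functions on $\mathcal{X}$. A stationary imprecise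 Markov chain (with infinite time horizon) has for each state $x\in\mathcal{X}$ a credal set $\mathcal{Q}(\cdot\mid x)$ of transition mass functions, the same at all times. Its upper transition operator $\overline{T}:\mathcal{L}(\mathcal{X})\to\mathcal{L}(\mathcal{X})$ is $\overline{T}h(x)=\max\{\sum_z h(z)q(z):q\in\mathcal{Q}(\cdot\mid x)\}$, and its lower transition operator is $\underline{T}h=-\overline{T}(-h)$. Powers denote iterated composition, with $\overline{T}^{\,0}=\mathrm{id}$. Let $\mathcal{R}=\{x\in\mathcal{X}:(\exists n\in\mathbb{N})(\forall k\ge n)(\forall y\in\mathcal{X})\ \overline{T}^{\,k}I_{\{x\}}(y)>0\}$. The chain is regularly absorbing if $\mathcal{R}\neq\emptyset$ and for every $y\in\mathcal{X}\setminus\mathcal{R}$ there is some $n\in\mathbb{N}$ such that $\underline{T}^{\,n}I_{\mathcal{R}}(y)>0$. An upper expectation $\overline{E}$ on $\mathcal{L}(\mathcal{X})$ is $\overline{T}$-invariant if $\overline{E}(\overline{T}h)=\overline{E}(h)$ for all $h\in\mathcal{L}(\mathcal{X})$. *)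

(* Defs.v *)
From mathcomp Require Import all_boot all_order all_algebra.
From mathcomp Require Import all_classical all_reals all_analysis.

Set Implicit Arguments.
Unset Strict Implicit.
Unset Printing Implicit Defensive.

Import Order.TTheory GRing.Theory Num.Theory.
Import numFieldNormedType.Exports.

Local Open Scope classical_set_scope.
Local Open Scope ring_scope.

(* Real-valued maps on the state set X are plain functions X -> R. *)

Definition mass_function (R : realType) (X : finType) (p : X -> R) : Prop :=
  (forall x, 0 <= p x) /\ \sum_x p x = 1.

(* {ptws X -> R} carries the product topology, i.e. the usual one of R^X. *)
Definition credal_set (R : realType) (X : finType) (P : set (X -> R)) : Prop :=
  [/\ P !=set0,
      closed (P : set {ptws X -> R}),
      convex_set (P : set (X -> R^o)) &
      P `<=` @mass_function R X].

(* The supremum is a maximum when Q x is a credal set: see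
   upper_transition_max below. *)
Definition upper_transition (R : realType) (X : finType)
    (Q : X -> set (X -> R)) (h : X -> R) : X -> R :=
  fun x => sup [set \sum_z h z * q z | q in Q x].

Definition lower_transition (R : realType) (X : finType)
    (T : (X -> R) -> X -> R) (h : X -> R) : X -> R :=
  fun x => - T (fun z => - h z) x.

Definition regular_states (R : realType) (X : finType)
    (T : (X -> R) -> X -> R) : set X :=
  [set x | exists n : nat, (1 <= n)%N /\
     forall k : nat, (n <= k)%N -> forall y, 0 < iter k T (\1_[set x]) y].

Definition regularly_absorbing (R : realType) (X : finType)
    (T : (X -> R) -> X -> R) : Prop :=
  regular_states T !=set0 /\
  forall y, ~ regular_states T y ->
    exists n : nat, (1 <= n)%N /\
      0 < iter n (lower_transition T) (\1_(regular_states T)) y.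

(* As X is finite, inf (range g) and sup (range g) are min g and max g. *)
Definition upper_expectation (R : realType) (X : finType)
    (E : (X -> R) -> R) : Prop :=
  [/\ forall g, inf (range g) <= E g <= sup (range g),
      forall g1 g2, E (fun x => g1 x + g2 x) <= E g1 + E g2 &
      forall (l : R) g, 0 <= l -> E (fun x => l * g x) = l * E g].

Definition transition_invariant (R : realType) (X : finType)
    (T : (X -> R) -> X -> R) (E : (X -> R) -> R) : Prop :=
  forall h, E (T h) = E h.

(* Times start at 1; the value at n = 0 is a dummy. *)
Definition expectation_at (R : realType) (X : finType)
    (T : (X -> R) -> X -> R) (E1 : (X -> R) -> R) (n : nat) : (X -> R) -> R :=
  fun h => E1 (iter n.-1 T h).

Lemma credal_set_compact (R : realType) (X : finType) (P : set (X -> R)) :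
  credal_set P -> compact (P : set {ptws X -> R}).
Proof.
move=> [_ Pcl _ Pm].
have K : compact [set f : {ptws X -> R} | forall x, `[0, 1]%classic (f x)].
  apply: (@tychonoff X (fun=> R) (fun=> `[0, 1]%classic)) => x.
  exact: segment_compact.
apply: subclosed_compact Pcl K _ => p /Pm [p0 p1] x /=.
rewrite in_itv/= p0 -p1 (bigD1 x)//= lerDl.
by apply: sumr_ge0.
Qed.

Lemma upper_transition_max (R : realType) (X : finType)
    (Q : X -> set (X -> R)) (h : X -> R) (x : X) :
  credal_set (Q x) ->
  exists2 q, Q x q & upper_transition Q h x = \sum_z h z * q z /\
    forall q', Q x q' -> \sum_z h z * q' z <= \sum_z h z * q z.
Proof.
move=> cQ; have [Q0 _ _ _] := cQ.
pose f (q : {ptws X -> R}) : R := \sum_z h z * q z.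
have fc : continuous f.
  refine (@continuous_big R X +%R 0 xpredT (@add_continuous _)
    {ptws X -> R} (index_enum X) (fun z (q : {ptws X -> R}) => h z * q z) _).
  move=> z _ q; apply: (@cvgM R _ (nbhs q) _ (fun=> h z)); first exact: cvg_cst.
  exact: (@proj_continuous _ (fun=> R) z q).
have [q] := @compact_EVT_max {ptws X -> R} R f (Q x) Q0
  (credal_set_compact cQ) (continuous_subspaceT fc).
rewrite inE => Qq qmax; exists q => //; split; last first.
  by move=> q' Qq'; apply: qmax; rewrite inE.
apply/eqP; rewrite eq_le; apply/andP; split.
  apply: ge_sup; first by exists (f q), q.
  by move=> _ [q' Qq' <-]; apply: qmax; rewrite inE.
apply: ub_le_sup; last by exists q.
by exists (f q) => _ [q' Qq' <-]; apply: qmax; rewrite inE.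
Qed.

(* Main.v *)
Require Import Defs.
From mathcomp Require Import all_boot all_order all_algebra.
From mathcomp Require Import all_classical all_reals all_analysis.
From mathcomp Require Import ring lra.

Set Implicit Arguments.
Unset Strict Implicit.

Import Order.TTheory GRing.Theory Num.Theory.
Import numFieldNormedType.Exports.

Local Open Scope classical_set_scope.
Local Open Scope ring_scope.

(** Write T for the upper transition operator, A for the set of regular states,
    and osc h for max h - min h. Three facts about T matter: each h |-> T h x is
    an upper expectation, so T is monotone, positively homogeneous and commutes
    with adding constants; the iterates of T inherit this; and the lower
    probability of reaching A is positive.

    A is closed: a regular state can only move to regular states, so the lower
    probability of staying in A is 1 ([regular_states_closed]). Hence the lower
    probability of being in A after n steps is nondecreasing in n, and
    finiteness of X yields one horizon k and one e > 0 such that, after k steps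
    from any state, every single regular state has upper probability at least e
    and the set A has lower probability at least e
    ([regularly_absorbing_uniform]).

    This forces osc (T^k h) <= (1 - e / 2) * osc h ([osc_contract]). If h is at
    least its midrange at some regular state, the first bound raises the minimum
    by at least e / 2 * osc h; otherwise h is below its midrange on all of A,
    and the second bound lowers the maximum by at least that amount.

    The maxima of T^n h decrease and the minima increase, so they converge, and
    the contraction makes their limits equal: this common limit is the value of
    the limit expectation at h ([sup_inf_iter_cvg]). Every upper expectation of
    T^n h is squeezed between the two. Taking evaluation at a state as the
    initial expectation shows that the limit is itself an upper expectation and
    that it is invariant; an invariant E has E (T^n h) = E h for all n, hence
    coincides with the limit. *)

(** * Extrema of maps on a finite set *)

Lemma has_ubound_range {R : realType} {X : finType} (g : X -> R) :
  has_ubound (range g).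
Proof.
exists (\sum_z `|g z|) => _ [x _ <-].
rewrite (bigD1 x)//=; apply: (le_trans (ler_norm _)).
by rewrite lerDl sumr_ge0.
Qed.

Lemma has_lbound_range {R : realType} {X : finType} (g : X -> R) :
  has_lbound (range g).
Proof.
exists (- \sum_z `|g z|) => _ [x _ <-].
rewrite lerNl (bigD1 x)//=; apply: (@le_trans _ _ `|g x|).
  by rewrite -normrN ler_norm.
by rewrite lerDl sumr_ge0.
Qed.

Lemma le_sup_range {R : realType} {X : finType} (g : X -> R) x :
  g x <= sup (range g).
Proof. by apply: ub_le_sup; [exact: has_ubound_range | exists x]. Qed.

Lemma ge_inf_range {R : realType} {X : finType} (g : X -> R) x :
  inf (range g) <= g x.
Proof. by apply: ge_inf; [exact: has_lbound_range | exists x]. Qed.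

Lemma sup_range_le {R : realType} {X : finType} (x0 : X) (g : X -> R) c :
  (forall x, g x <= c) -> sup (range g) <= c.
Proof.
by move=> gc; apply: ge_sup; [exists (g x0), x0 | move=> _ [x _ <-]].
Qed.

Lemma inf_range_ge {R : realType} {X : finType} (x0 : X) (g : X -> R) c :
  (forall x, c <= g x) -> c <= inf (range g).
Proof.
by move=> gc; apply: lb_le_inf; [exists (g x0), x0 | move=> _ [x _ <-]].
Qed.

Lemma indic_ge0 {R : realType} {X : finType} (A : set X) x :
  0 <= \1_A x :> R.
Proof. by rewrite indicE ler0n. Qed.

(** * Upper expectations *)

Section UpperExpectation.
Context {R : realType} {X : finType} {E : (X -> R) -> R}.
Hypothesis Eup : upper_expectation E.

Lemma uexp_le (x0 : X) g c : (forall x, g x <= c) -> E g <= c.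
Proof.
have [/(_ g)/andP[_ gsup] _ _] := Eup.
by move=> gc; apply: le_trans gsup (sup_range_le x0 gc).
Qed.

Lemma uexp_ge (x0 : X) g c : (forall x, c <= g x) -> c <= E g.
Proof.
have [/(_ g)/andP[ginf _] _ _] := Eup.
by move=> gc; apply: le_trans (inf_range_ge x0 gc) ginf.
Qed.

Lemma uexp_mono (x0 : X) g h : (forall x, g x <= h x) -> E g <= E h.
Proof.
move=> gh; have [_ /(_ h (fun x => g x - h x)) + _] := Eup.
under eq_fun do rewrite addrC subrK.
move=> /le_trans; apply; rewrite gerDl.
by apply: (uexp_le x0) => x; rewrite subr_le0.
Qed.

Lemma uexpD (g h : X -> R) : E (fun x => g x + h x) <= E g + E h.
Proof. by case: Eup. Qed.

Lemma uexpZ (l : R) g : 0 <= l -> E (fun x => l * g x) = l * E g.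
Proof. by case: Eup => _ _; apply. Qed.

Lemma uexp_addc (x0 : X) g c : E (fun x => g x + c) = E g + c.
Proof.
apply/eqP; rewrite eq_le; apply/andP; split.
  by apply: le_trans (uexpD _ _) _; rewrite lerD2l; exact: uexp_le.
rewrite -lerBrDr.
have := uexpD (fun x => g x + c) (fun=> - c).
under eq_fun do rewrite addrK.
by move=> /le_trans; apply; rewrite lerD2l; exact: uexp_le.
Qed.

(** By subadditivity, a set of states has upper probability zero as soon as each
    of its states has. *)
Lemma uexp_indic0 (A : set X) :
  (forall x, A x -> E (\1_[set x]) = 0) -> E (\1_A) <= 0.
Proof.
move=> A0.
have -> : \1_A = (fun z => \sum_(x | x \in A) \1_[set x] z) :> (X -> R).
  apply/funext => z; rewrite indicE; have [zA|zA] := boolP (z \in A).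
    rewrite (bigD1 z)//= indicE mem_set// big1 ?addr0// => x /andP[_ xz].
    by rewrite indicE memNset// => zx; rewrite zx eqxx in xz.
  rewrite big1// => x xA; rewrite indicE memNset// => zx.
  by rewrite zx xA in zA.
elim: (index_enum X) => [|x s IH].
  under eq_fun do rewrite big_nil.
  (* E 0 = 0 by homogeneity with factor 0. *)
  have := @uexpZ 0 (fun=> 0) (lexx _).
  by under eq_fun do rewrite mulr0; rewrite mul0r => ->.
under eq_fun do rewrite big_cons.
have [xA|_ //] := boolP (x \in A); apply: le_trans (uexpD _ _) _.
by rewrite A0 ?add0r//; rewrite inE in xA.
Qed.

End UpperExpectation.

Lemma uexp_eval {R : realType} {X : finType} (x : X) :
  upper_expectation (fun g : X -> R => g x).
Proof. by split=> // g; rewrite ge_inf_range le_sup_range. Qed.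

(** * Upper transition operators *)

(** One upper expectation per state, collected into a map from functions to
    functions. An upper transition operator is of this form, and so are its
    iterates. *)
Definition upper_operator {R : realType} {X : finType}
  (T : (X -> R) -> X -> R) := forall x, upper_expectation (fun h => T h x).

Lemma upper_transition_operator {R : realType} {X : finType}
    (Q : X -> set (X -> R)) :
  (forall x, credal_set (Q x)) -> upper_operator (upper_transition Q).
Proof.
move=> Qc x; split=> [g|g1 g2|l g l0].
- have [q Qq [-> _]] := upper_transition_max g (Qc x).
  have [_ _ _ /(_ q Qq)[q0 q1]] := Qc x.
  apply/andP; split.
    rewrite -[leLHS]mulr1 -q1 mulr_sumr; apply: ler_sum => z _.
    by rewrite ler_wpM2r ?ge_inf_range.
  rewrite -[leRHS]mulr1 -q1 mulr_sumr; apply: ler_sum => z _.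
  by rewrite ler_wpM2r ?le_sup_range.
- have [q Qq [-> _]] := upper_transition_max (fun z => g1 z + g2 z) (Qc x).
  have [q1 _ [-> m1]] := upper_transition_max g1 (Qc x).
  have [q2 _ [-> m2]] := upper_transition_max g2 (Qc x).
  under eq_bigr do rewrite mulrDl.
  by rewrite big_split lerD ?m1 ?m2.
- have [q Qq [-> m]] := upper_transition_max (fun z => l * g z) (Qc x).
  have [q' Qq' [-> m']] := upper_transition_max g (Qc x).
  have lE p : \sum_z l * g z * p z = l * \sum_z g z * p z.
    by rewrite mulr_sumr; apply: eq_bigr => z _; rewrite mulrA.
  apply/eqP; rewrite eq_le; apply/andP; split.
    by rewrite lE ler_wpM2l ?m'.
  by rewrite -lE m.
Qed.

Lemma uexp_comp {R : realType} {X : finType} (T : (X -> R) -> X -> R) E :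
  upper_operator T -> upper_expectation E -> upper_expectation (E \o T).
Proof.
move=> Tup Eup; split=> [g|g1 g2|l g l0] /=.
- have [x0 _|X0] := pickP (fun _ : X => true).
    apply/andP; split.
      by apply: (uexp_ge Eup x0) => x; have [/(_ g)/andP[]] := Tup x.
    by apply: (uexp_le Eup x0) => x; have [/(_ g)/andP[]] := Tup x.
  (* On an empty X all functions are equal. *)
  have -> : T g = g by apply/funext => x; have := X0 x.
  by have [+ _ _] := Eup.
- have [x0 _|X0] := pickP (fun _ : X => true).
    apply: le_trans (uexpD Eup _ _).
    by apply: (uexp_mono Eup x0) => x; have [_ + _] := Tup x.
  have TE g : T g = g by apply/funext => x; have := X0 x.
  by rewrite !TE; exact: uexpD.
- rewrite -(uexpZ Eup)//; congr E; apply/funext => x.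
  by have [_ _ ->] := Tup x.
Qed.

Lemma uexp_iter {R : realType} {X : finType} (T : (X -> R) -> X -> R) E n :
  upper_operator T -> upper_expectation E ->
  upper_expectation (fun h => E (iter n T h)).
Proof.
move=> Tup; elim: n E => [//|n IH] E Eup /=.
exact: (IH (E \o T) (uexp_comp Tup Eup)).
Qed.

Lemma upper_operator_iter {R : realType} {X : finType}
    (T : (X -> R) -> X -> R) n :
  upper_operator T -> upper_operator (iter n T).
Proof.
by move=> Tup x; exact: (uexp_iter n Tup (uexp_eval x)).
Qed.

Lemma iter_lower_transition {R : realType} {X : finType}
    (T : (X -> R) -> X -> R) n :
  iter n (lower_transition T) = lower_transition (iter n T).
Proof.
apply/funext => h; elim: n => [|n IH] /=.
  by apply/funext => x; rewrite /lower_transition opprK.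
rewrite IH /lower_transition; apply/funext => x; congr (- T _ x).
by apply/funext => z; rewrite opprK.
Qed.

(** * Regular states form a closed class *)

(** If y can move to z in one step and y is regular, then z is regular: a path
    of any large length to y extends to z. *)
Lemma regular_states_step {R : realType} {X : finType}
    (T : (X -> R) -> X -> R) y z :
  upper_operator T -> regular_states T y -> 0 < T (\1_[set z]) y ->
  regular_states T z.
Proof.
move=> Tup [n [n1 ny]] yz; exists n.+1; split=> // -[//|k] nk w.
rewrite iterSr; have Tkw := upper_operator_iter k Tup w.
apply: lt_le_trans (uexp_mono Tkw y (g := fun x => T (\1_[set z]) y *
  \1_[set y] x) _).
  by rewrite (uexpZ Tkw) ?(ltW yz)// mulr_gt0// ny.
move=> x; rewrite indicE; have [->|xy] := eqVneq x y.
  by rewrite mem_set// mulr1.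
rewrite memNset ?mulr0; last by move=> /= xy'; rewrite xy' eqxx in xy.
by apply: (uexp_ge (Tup x) x) => u; exact: indic_ge0.
Qed.

Lemma regular_states_closed {R : realType} {X : finType}
    (T : (X -> R) -> X -> R) y :
  upper_operator T -> regular_states T y ->
  1 <= lower_transition T (\1_(regular_states T)) y.
Proof.
move=> Tup Ry; rewrite /lower_transition lerNr.
(* The complement formula for indicators reduces the claim to the upper
   probability of leaving the regular states being zero. *)
have -> : (fun z => - \1_(regular_states T) z) =
    (fun z => \1_(~` regular_states T) z + (-1)) :> (X -> R).
  apply/funext => z; rewrite !indicE in_setC.
  by case: (z \in _); rewrite ?add0r ?subrr ?oppr0.
rewrite (uexp_addc (Tup y) y) gerDr.
apply: (uexp_indic0 (Tup y)) => z nRz; apply/eqP; rewrite eq_le.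
have -> : 0 <= T (\1_[set z]) y.
  by apply: (uexp_ge (Tup y) y) => u; exact: indic_ge0.
rewrite andbT leNgt; apply/negP => yz.
exact: nRz (regular_states_step Tup Ry yz).
Qed.

(** Since the set of regular states is closed, the lower probability of being in
    it after n steps can only grow with n. *)
Lemma lower_iter_nondecreasing {R : realType} {X : finType}
    (T : (X -> R) -> X -> R) y :
  upper_operator T ->
  nondecreasing_seq
    (fun n => iter n (lower_transition T) (\1_(regular_states T)) y).
Proof.
move=> Tup; apply/nondecreasing_seqP => n; rewrite iterSr.
rewrite iter_lower_transition /lower_transition lerN2.
apply: (uexp_mono (upper_operator_iter n Tup y) y) => x.
rewrite lerN2 indicE; have [Rx|_] := boolP (x \in _).
  by apply: regular_states_closed => //; rewrite inE in Rx.
rewrite lerNr oppr0; apply: (uexp_le (Tup x) x) => z.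
by rewrite lerNl oppr0 indic_ge0.
Qed.

(** * Contraction of the oscillation *)

(** The oscillation max h - min h. *)
Definition osc {R : realType} {X : finType} (h : X -> R) : R :=
  sup (range h) - inf (range h).

Lemma osc_ge0 {R : realType} {X : finType} (x0 : X) (h : X -> R) : 0 <= osc h.
Proof.
by rewrite subr_ge0 (le_trans (ge_inf_range h x0))// le_sup_range.
Qed.

(** Either h is at least its midrange at some state of A, and then the minimum
    rises by half of osc h times the upper probability of that state, or h is
    below its midrange on all of A, and then the maximum falls by half of osc h
    times the lower probability of A. *)
Lemma osc_contract {R : realType} {X : finType} (x0 : X)
    (S : (X -> R) -> X -> R) (A : set X) (e : R) h :
  upper_operator S ->
  (forall x y, A x -> e <= S (\1_[set x]) y) ->
  (forall y, e <= lower_transition S (\1_A) y) ->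
  osc (S h) <= (1 - e / 2) * osc h.
Proof.
move=> Sup eA eS; have o0 := osc_ge0 x0 h.
set M := sup (range h); set m := inf (range h); set d := osc h / 2.
have d0 : 0 <= d by rewrite divr_ge0.
have dE : 2 * d = M - m by rewrite /d mulrC divfK.
have SM y : S h y <= M by apply: (uexp_le (Sup y) x0) => x; exact: le_sup_range.
have Sm y : m <= S h y by apply: (uexp_ge (Sup y) x0) => x; exact: ge_inf_range.
have oE : (1 - e / 2) * osc h = 2 * d - d * e by rewrite /d; field.
rewrite oE dE /osc.
have [[x [Ax hx]]|hA] := pselect (exists x, A x /\ m + d <= h x).
  suff Smd y : m + d * e <= S h y.
    have := inf_range_ge x0 Smd; have := sup_range_le x0 SM; lra.
  (* Here h dominates m + d * 1_{x}, because h >= m everywhere. *)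
  apply: le_trans (uexp_mono (Sup y) x0 (g := fun z => d * \1_[set x] z + m) _).
    rewrite (uexp_addc (Sup y) x0) (uexpZ (Sup y))// addrC.
    by rewrite lerD2r ler_wpM2l ?eA.
  move=> z; rewrite indicE; have [zx|zx] := boolP (z \in _).
    by rewrite inE /= in zx; rewrite zx mulr1 addrC.
  by rewrite mulr0 add0r ge_inf_range.
suff SMd y : S h y <= M - d * e.
  have := inf_range_ge x0 Sm; have := sup_range_le x0 SMd; lra.
(* Here h is dominated by M - d * 1_A, because m + d = M - d. *)
apply: le_trans (uexp_mono (Sup y) x0 (h := fun z => d * - \1_A z + M) _) _.
  move=> z; rewrite indicE; have [zA|zA] := boolP (z \in _).
    rewrite mulrN1; rewrite inE in zA.
    have : h z < m + d by rewrite ltNge; apply/negP => ?; apply: hA; exists z.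
    lra.
  by rewrite oppr0 mulr0 add0r le_sup_range.
rewrite (uexp_addc (Sup y) x0) (uexpZ (Sup y))// addrC lerD2l -mulrN.
by rewrite ler_wpM2l// lerNr eS.
Qed.

(** In a regularly absorbing chain one horizon and one constant serve for all
    states at once. *)
Lemma regularly_absorbing_uniform {R : realType} {X : finType}
    (T : (X -> R) -> X -> R) :
  upper_operator T -> regularly_absorbing T ->
  exists k (e : R), [/\ 0 < e,
    forall x y, regular_states T x -> e <= iter k T (\1_[set x]) y &
    forall y, e <= lower_transition (iter k T) (\1_(regular_states T)) y].
Proof.
move=> Tup [_ abs].
have reg : \forall k \near \oo, forall x,
    regular_states T x -> forall y, 0 < iter k T (\1_[set x]) y.
  apply: filter_forall => x.
  have [[n [_ nx]]|nRx] := pselect (regular_states T x).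
    by exists n => // k nk _ y; exact: nx.
  by apply: nearW => k /nRx.
have low : \forall k \near \oo, forall y,
    0 < iter k (lower_transition T) (\1_(regular_states T)) y.
  apply: filter_forall => y.
  have [n ny] : exists n,
      0 < iter n (lower_transition T) (\1_(regular_states T)) y.
    have [Ry|/abs[n [_ ny]]] := pselect (regular_states T y); last by exists n.
    (* From a regular state, zero steps already suffice. *)
    by exists 0%N; rewrite /= indicE mem_set.
  exists n => // k nk.
  exact: lt_le_trans ny (lower_iter_nondecreasing y Tup nk).
have [k [kreg klow]] := filter_ex (filterI reg low).
have e1 : \forall e \near 0^'+, forall x y, regular_states T x ->
    e <= iter k T (\1_[set x]) y.
  apply: filter_forall => x; apply: filter_forall => y.
  have [Rx|nRx] := pselect (regular_states T x); last by apply: nearW.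
  by apply: filterS (nbhs_right_le (kreg x Rx y)).
have e2 : \forall e \near 0^'+, forall y,
    e <= iter k (lower_transition T) (\1_(regular_states T)) y.
  by apply: filter_forall => y; exact: nbhs_right_le (klow y).
have [e [[e0 ereg] elow]] :=
  filter_ex (filterI (filterI (nbhs_right_gt (0 : R)) e1) e2).
by exists k, e; split=> // y; rewrite -iter_lower_transition.
Qed.

(** * Convergence *)

Lemma sup_iter_nonincreasing {R : realType} {X : finType} (x0 : X)
    (T : (X -> R) -> X -> R) h :
  upper_operator T ->
  nonincreasing_seq (fun n => sup (range (iter n T h))).
Proof.
move=> Tup; apply/nonincreasing_seqP => n /=; apply: (sup_range_le x0) => x.
by apply: (uexp_le (Tup x) x0) => z; exact: le_sup_range.
Qed.

Lemma inf_iter_nondecreasing {R : realType} {X : finType} (x0 : X)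
    (T : (X -> R) -> X -> R) h :
  upper_operator T ->
  nondecreasing_seq (fun n => inf (range (iter n T h))).
Proof.
move=> Tup; apply/nondecreasing_seqP => n /=; apply: (inf_range_ge x0) => x.
by apply: (uexp_ge (Tup x) x0) => z; exact: ge_inf_range.
Qed.

(** The limits of the maxima and of the minima differ by at most (1 - e / 2)
    times their difference, hence agree. *)
Lemma sup_inf_iter_cvg {R : realType} {X : finType} (x0 : X)
    (T : (X -> R) -> X -> R) h :
  upper_operator T -> regularly_absorbing T ->
  exists l : R, sup (range (iter n T h)) @[n --> \oo] --> l /\
                inf (range (iter n T h)) @[n --> \oo] --> l.
Proof.
move=> Tup /(regularly_absorbing_uniform Tup)[k [e [e0 ereg elow]]].
set u := fun n => sup (range (iter n T h)).
set v := fun n => inf (range (iter n T h)).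
have unn : nonincreasing_seq u := sup_iter_nonincreasing x0 h Tup.
have vnn : nondecreasing_seq v := inf_iter_nondecreasing x0 h Tup.
have vu n : v n <= u n := le_trans (ge_inf_range _ x0) (le_sup_range _ x0).
have cu : cvgn u.
  apply: nonincreasing_is_cvgn unn _; exists (v 0) => _ [n _ <-].
  exact: le_trans (vnn _ _ (leq0n n)) (vu n).
have cv : cvgn v.
  apply: nondecreasing_is_cvgn vnn _; exists (u 0) => _ [n _ <-].
  exact: le_trans (vu n) (unn _ _ (leq0n n)).
have cd : (u n - v n) @[n --> \oo] --> limn u - limn v by exact: cvgB.
have d0 : 0 <= limn u - limn v.
  rewrite subr_ge0; apply: ler_lim => //; exact: nearW.
have : limn u - limn v <= (1 - e / 2) * (limn u - limn v).
  have cdk : (u (n + k)%N - v (n + k)%N) @[n --> \oo] --> limn u - limn v.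
    by rewrite (cvg_shiftn k (fun n => u n - v n)).
  apply: (ler_cvg_to cdk (cvgM (cvg_cst _) cd)); apply: nearW => n /=.
  rewrite /u /v addnC iterD.
  exact: (osc_contract x0 _ (upper_operator_iter k Tup) ereg elow).
move=> dle; have : limn u - limn v = 0 by nra.
by move=> /subr0_eq uv; exists (limn u); split=> //; rewrite uv.
Qed.

Unset Implicit Arguments.

Theorem theorem5p1 (R : realType) (X : finType) (X_nonempty : (0 < #|X|)%N)
    (Q : X -> set (X -> R)) (Q_credal : forall x, credal_set (Q x))
    (Q_absorbing : regularly_absorbing (upper_transition Q)) :
  exists Einf : (X -> R) -> R,
    [/\ upper_expectation Einf,
        forall E1 : (X -> R) -> R, upper_expectation E1 ->
          forall h : X -> R,
            expectation_at (upper_transition Q) E1 n h @[n --> \oo] --> Einf h,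
        transition_invariant (upper_transition Q) Einf &
        forall E : (X -> R) -> R, upper_expectation E ->
          transition_invariant (upper_transition Q) E -> E = Einf].
Proof.
have [x0 _] : exists x : X, x \in X by exact/card_gt0P.
have Tup := upper_transition_operator Q_credal.
move: (upper_transition Q) Q_absorbing Tup => T Tabs Tup {Q Q_credal}.
have [Einf cvE] := choice (fun h => sup_inf_iter_cvg x0 h Tup Tabs).
have cvE1 E1 h : upper_expectation E1 ->
    E1 (iter n T h) @[n --> \oo] --> Einf h.
  move=> [E1b _ _]; have [cs ci] := cvE h.
  by apply: (squeeze_cvgr _ ci cs); apply: nearW => n; exact: E1b.
have cvx h : iter n T h x0 @[n --> \oo] --> Einf h := cvE1 _ h (uexp_eval x0).
have Tn n : upper_expectation (fun h => iter n T h x0) :=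
  upper_operator_iter n Tup x0.
have invE : transition_invariant T Einf.
  move=> h; suff cTh : iter n T (T h) x0 @[n --> \oo] --> Einf h.
    exact: cvg_unique (cvx (T h)) cTh.
  under eq_fun do rewrite -iterSr -addn1.
  by have := cvx h; rewrite -(cvg_shiftn 1).
exists Einf; split=> //.
- split=> [g|g1 g2|l g l0].
  + apply/andP; split.
      apply: (ler_cvg_to (cvg_cst _) (cvx g)); apply: nearW => n.
      by have [/(_ g)/andP[]] := Tn n.
    apply: (ler_cvg_to (cvx g) (cvg_cst _)); apply: nearW => n.
    by have [/(_ g)/andP[]] := Tn n.
  + apply: (ler_cvg_to (cvx _) (cvgD (cvx g1) (cvx g2))).
    by apply: nearW => n; exact: (uexpD (Tn n)).
  + suff cZ : iter n T (fun x => l * g x) x0 @[n --> \oo] --> l * Einf g.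
      exact: cvg_unique (cvx _) cZ.
    under eq_fun => n do rewrite (uexpZ (Tn n) g l0).
    exact: cvgM (cvg_cst _) (cvx g).
- move=> E1 E1up h; rewrite -(cvg_shiftn 1) /expectation_at.
  by under eq_fun do rewrite addn1 /=; exact: cvE1.
- move=> E Eup Einv; apply/funext => h.
  have En n : E (iter n T h) = E h by elim: n => //= n <-; exact: Einv.
  have := cvE1 E h Eup; under eq_fun do rewrite En.
  by move=> /(cvg_unique _ (cvg_cst _)); apply.
Qed.
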